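(* Let $(J,\beta)$ be a unital pseudo-Euclidean Jordan superalgebra with positive even part, let $\{e_i\}_{i=1}^r$ be a Jordan frame of $J_0$ with Peirce spaces $P_{ij}$, and let $\xi=\sum_{i=1}^r\lambda_ie_i^\flat\in J_0^*$ (that is, $\xi^\sharp=\sum_{i=1}^r\lambda_ie_i$). Then the canonical bilinear pairing $\mathcal{g}$ at $\xi$ can be expressed as $$\mathcal{g}_\xi=\sum_{\lambda_i\neq0\ \mathrm{or}\ \lambda_j\neq0}\frac{2}{\lambda_i+\lambda_j}\,\beta^\flat|_{P_{ij}^\flat},$$ where $\beta^\flat(\xi_1,\xi_2):=\beta(\xi_1^\sharp,\xi_2^\sharp)$ and the summation is taken over $1\le i\le j\le r$.
   Context: A superalgebra is a $\mathbb{Z}_2$-graded real (not necessarily associative) algebra $A=A_0\oplus A_1$ with $A_iA_j\subset A_{i+j}$, here of finite dimension; $|a|$ is the parity of a homogeneous $a$. $\mathrm{gl}(A)$ is a Lie superalgebra with $[f,g]=f\circ g-(-1)^{|f||g|}g\circ f$; $L_a$ is left multiplication by $a$. A Jordan superalgebra $J$ is a superalgebra with product $\{\cdot,\cdot\}$ satisfying $\{a,b\}=(-1)^{|a||b|}\{b,a\}$ and $[L_a,L_{\{b,c\}}]=[L_{\{a,b\}},L_c]-(-1)^{|a||b|}[L_b,L_{\{a,c\}}]$. $(J,\beta)$ is pseudo-Euclidean if $\beta$ is a bilinear form on $J$ that is even ($\beta(J_0,J_1)=0=\beta(J_1,J_0)$), symmetric ($\beta(a,b)=(-1)^{|a||b|}\beta(b,a)$),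 non-degenerate and associative ($\beta(\{a,b\},c)=\beta(a,\{b,c\})$). ''Positive even part'' means that the Jordan algebra $J_0$ is positive, i.e. $\tau(a,b)=\mathrm{tr}(L_{\{a,b\}}|_{J_0})$ is associative and positive definite on $J_0$. The form $\beta$ gives $\flat:J\to J^*$, $x\mapsto x^\flat=\beta(x,\cdot)$, with inverse $\sharp$; $P_{ij}^\flat$ is the image of $P_{ij}$. An idempotent $e\in J_0$ is primitive if it is nonzero and not a sum of two nonzero idempotents. A Jordan frame is a collection $\{e_i\}_{i=1}^r$ of primitive idempotents in $J_0$ with $\{e_i,e_j\}=\delta_{ij}e_i$ and $\sum_ie_i=1$. Its Peirce spaces are $P_{ii}=\{x\in J:\{e_i,x\}=x\}$ and, for $i\ne j$, $P_{ij}=P_{ji}=\{x\in J:\{e_i,x\}=\{e_j,x\}=\frac12x\}$; $J=\bigoplus_{i\le j}P_{ij}$. $J^*$ is regarded as a supermanifold with underlying space $J_0^*$ and structure sheaf $\mathcal{O}_{J^*}(U)=C^\infty(U)\otimes\Lambda(J_1)$; elements of $J$ are viewed as linear functions on $J^*$. Each $a\in J$ defines a vector field $X_a=\sum_k\{a,x_k\}\frac{\partial}{\partial x_k}$ on $J^*$, where $(x_k)$ is a homogeneous basis of $J$ regarded as linear coordinates on $J^*$. The canonical pairing $\mathcal{g}$ is the even symmetric $\mathcal{O}_{J^*}$-bilinear pairing on the distribution spanned by the vector fields $X_a$, determined by $\mathcal{g}(X_a,X_b)=\{a,b\}$. Its value $\mathcal{g}_\xi$ at $\xi\in J_0^*$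 is obtained by evaluating at $\xi$: the vector field $X_a$ has value $\xi\circ L_a\in J^*\cong T_\xi J^*$ at $\xi$, and $\mathcal{g}_\xi(\xi\circ L_a,\xi\circ L_b)=\xi(\{a,b\})$.
   Formalization: If λ_i+λ_j=0 with λ_i≠0 and P_ij≠0, the printed formula divides by zero; equality of the domain of g_ξ with the sum of the P_ij^♭ is stated only when this does not occur, while the formula for values on that domain is stated for all λ, reading 2/0 as 0. *)

(* Defs.v *)
From HB Require Import structures.
From mathcomp Require Import all_boot all_order all_algebra.
From mathcomp Require Import reals.

Set Implicit Arguments.
Unset Strict Implicit.
Unset Printing Implicit Defensive.

Import Order.TTheory GRing.Theory Num.Theory.

Local Open Scope ring_scope.

Section Superalgebra.

Context {R : realType} {J : vectType R}.

(* [part false] and [part true] are J_0 and J_1; Z/2 is bool with (+).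
   The product is given by left multiplications: {a, b} = mul a b, L_a = mul a. *)
Variables (part : bool -> {vspace J}) (mul : 'Hom(J, 'End(J))).

Record superalgebra : Prop := Superalgebra {
  part_sum : (part false + part true)%VS = fullv;
  part_cap : (part false :&: part true)%VS = 0%VS;
  part_mul : forall (i j : bool) (a b : J),
    a \in part i -> b \in part j -> mul a b \in part (i (+) j) }.

(* The bracket [f, g] of gl(J), for f of parity i and g of parity j. *)
Definition scomm (i j : bool) (f g : 'End(J)) : 'End(J) :=
  (f \o g)%VF - (-1) ^+ (i && j) *: (g \o f)%VF.

(* L_a has the parity of a, and L_{a,b} the parity |a| + |b|. *)
Record jordan_superalgebra : Prop := JordanSuperalgebra {
  jordan_super :> superalgebra;
  jordan_comm : forall (i j : bool) (a b : J), a \in part i -> b \in part j ->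
    mul a b = (-1) ^+ (i && j) *: mul b a;
  jordan_identity : forall (i j k : bool) (a b c : J),
    a \in part i -> b \in part j -> c \in part k ->
    scomm i (j (+) k) (mul a) (mul (mul b c)) =
      scomm (i (+) j) k (mul (mul a b)) (mul c)
      - (-1) ^+ (i && j) *: scomm j (i (+) k) (mul b) (mul (mul a c)) }.

Definition is_unit (one : J) : Prop :=
  forall x : J, mul one x = x /\ mul x one = x.

(* A bilinear form is given by x |-> beta(x, .), so that beta itself is the
   map flat : J -> J^*. *)
Record pseudo_euclidean (beta : 'Hom(J, 'Hom(J, R^o))) : Prop :=
  PseudoEuclidean {
  form_even : forall (i j : bool) (a b : J), i != j ->
    a \in part i -> b \in part j -> beta a b = 0;
  form_sym : forall (i j : bool) (a b : J), a \in part i -> b \in part j ->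
    beta a b = (-1) ^+ (i && j) * beta b a;
  form_nondegenerate : forall a : J, (forall b : J, beta a b = 0) -> a = 0;
  form_assoc : forall a b c : J, beta (mul a b) c = beta a (mul b c) }.

(* Trace of the restriction of f to an f-stable subspace U. *)
Definition trace_on (U : {vspace J}) (f : 'End(J)) : R :=
  \sum_(i < \dim U) coord (vbasis U) i (f (vbasis U)`_i).

Definition tau (a b : J) : R := trace_on (part false) (mul (mul a b)).

Definition positive_even_part : Prop :=
  (forall a b c : J, a \in part false -> b \in part false -> c \in part false ->
     tau (mul a b) c = tau a (mul b c)) /\
  (forall a : J, a \in part false -> a != 0 -> 0 < tau a a).

Definition idempotent_elt (e : J) : Prop := e \in part false /\ mul e e = e.

Definition primitive_idempotent (e : J) : Prop :=
  [/\ idempotent_elt e, e != 0 &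
      forall e1 e2 : J, idempotent_elt e1 -> idempotent_elt e2 ->
        e1 != 0 -> e2 != 0 -> e <> e1 + e2].

Record jordan_frame (one : J) (r : nat) (e : 'I_r -> J) : Prop := JordanFrame {
  frame_primitive : forall i : 'I_r, primitive_idempotent (e i);
  frame_orthogonal : forall i j : 'I_r,
    mul (e i) (e j) = if i == j then e i else 0;
  frame_sum : \sum_(i < r) e i = one }.

Definition peirce (r : nat) (e : 'I_r -> J) (i j : 'I_r) : {vspace J} :=
  if i == j then passmx.leigenspace (mul (e i)) 1
  else (passmx.leigenspace (mul (e i)) (1 / 2)%R
        :&: passmx.leigenspace (mul (e j)) (1 / 2)%R)%VS.

Definition sharp (beta : 'Hom(J, 'Hom(J, R^o))) : 'Hom('Hom(J, R^o), J) :=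
  (beta^-1)%VF.

Definition beta_flat (beta : 'Hom(J, 'Hom(J, R^o))) (x1 x2 : 'Hom(J, R^o)) : R :=
  beta (sharp beta x1) (sharp beta x2).

Definition peirce_flat (beta : 'Hom(J, 'Hom(J, R^o))) (r : nat) (e : 'I_r -> J)
    (i j : 'I_r) : {vspace 'Hom(J, R^o)} :=
  (beta @: peirce e i j)%VS.

(* The projection of J^* onto the summand P_ij^flat (p = (i, j), i <= j) of the
   decomposition of J^* as the direct sum of the P_kl^flat, k <= l. *)
Definition peirce_flat_proj (beta : 'Hom(J, 'Hom(J, R^o))) (r : nat)
    (e : 'I_r -> J) (p : 'I_r * 'I_r) : 'End('Hom(J, R^o)) :=
  sumv_pi (\sum_(q : 'I_r * 'I_r | (q.1 <= q.2)%N)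
             peirce_flat beta e q.1 q.2)%VS p.

(* beta^flat restricted to P_ij^flat, as a form on J^* that vanishes on the other
   summands P_kl^flat.  Where g_xi has a term 2 / (lambda_i + lambda_j) with zero
   denominator, the P_ij^flat components of vectors in the distribution at xi
   vanish, so that the value given to 2 / 0 does not matter. *)
Definition beta_flat_on (beta : 'Hom(J, 'Hom(J, R^o))) (r : nat) (e : 'I_r -> J)
    (i j : 'I_r) (x1 x2 : 'Hom(J, R^o)) : R :=
  beta_flat beta (peirce_flat_proj beta e (i, j) x1)
                 (peirce_flat_proj beta e (i, j) x2).

(* A point of J_0^* is a linear form on J that vanishes on J_1. *)
Definition even_form (xi : 'Hom(J, R^o)) : Prop :=
  forall x : J, x \in part true -> xi x = 0.

(* The value at xi of X_a = sum_k {a, x_k} d/dx_k: the coefficients at xi are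
   xi({a, x_k}), and d/dx_k corresponds to the dual basis vector of x_k under
   T_xi J^* = J^*, whence xi \o L_a. *)
Definition vf_value (xi : 'Hom(J, R^o)) (a : J) : 'Hom(J, R^o) :=
  (xi \o mul a)%VF.

Lemma vf_value_is_linear (xi : 'Hom(J, R^o)) : linear (vf_value xi).
Proof.
move=> k a b; apply/lfunP=> x.
rewrite add_lfunE scale_lfunE !comp_lfunE.
have -> : mul (k *: a + b) x = k *: mul a x + mul b x.
  by rewrite linearP add_lfunE scale_lfunE.
exact: linearP.
Qed.

HB.instance Definition _ (xi : 'Hom(J, R^o)) :=
  GRing.isLinear.Build R J 'Hom(J, R^o) *:%R (vf_value xi)
    (vf_value_is_linear xi).

Definition distribution (xi : 'Hom(J, R^o)) : {vspace 'Hom(J, R^o)} :=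
  limg (linfun (vf_value xi)).

(* g_xi on the distribution at xi: g_xi(x1, x2) = xi({a, b}), where a and b are
   chosen with X_a, X_b of value x1, x2 at xi.  By [canonical_pairingE] the
   choice is immaterial.  Values outside the distribution are meaningless. *)
Definition canonical_pairing (xi x1 x2 : 'Hom(J, R^o)) : R :=
  let rep := ((linfun (vf_value xi))^-1)%VF in xi (mul (rep x1) (rep x2)).

Lemma form_mul_swap (xi : 'Hom(J, R^o)) (a0 a1 b0 b1 : J) :
  jordan_superalgebra -> even_form xi ->
  a0 \in part false -> a1 \in part true ->
  b0 \in part false -> b1 \in part true ->
  xi (mul (a0 + a1) (b0 + b1)) = xi (mul (b0 + b1) (a0 - a1)).
Proof.
move=> hJ hxi a0P a1P b0P b1P; have mulD x y u v : xi (mul (x + y) (u + v)) =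
    (xi (mul x u) + xi (mul x v)) + (xi (mul y u) + xi (mul y v)).
  by rewrite (linearD mul) add_lfunE (linearD (mul x)) (linearD (mul y))
    !(linearD xi).
have mulN x y : xi (mul x (- y)) = - xi (mul x y).
  by rewrite (linearN (mul x)) (linearN xi).
rewrite !mulD !mulN.
have := hxi _ (part_mul hJ a0P b1P); have := hxi _ (part_mul hJ a1P b0P).
have := hxi _ (part_mul hJ b0P a1P); have := hxi _ (part_mul hJ b1P a0P).
rewrite (jordan_comm hJ a0P b0P) (jordan_comm hJ a1P b1P) expr0 expr1.
by rewrite scale1r scaleN1r (linearN xi) => -> -> -> ->; rewrite oppr0 !addr0 !add0r.
Qed.

Lemma canonical_pairingE (xi : 'Hom(J, R^o)) (a b : J) :
  jordan_superalgebra -> even_form xi ->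
  canonical_pairing xi (vf_value xi a) (vf_value xi b) = xi (mul a b).
Proof.
move=> hJ hxi; rewrite /canonical_pairing; set X := linfun _.
have repK c : vf_value xi ((X^-1)%VF (vf_value xi c)) = vf_value xi c.
  have XE d : X d = vf_value xi d by rewrite lfunE.
  by rewrite -XE -[in LHS]XE limg_lfunVK // memv_img ?memvf.
set a' := (X^-1)%VF _; set b' := (X^-1)%VF _.
have xiE c c' d : vf_value xi c = vf_value xi c' -> xi (mul c d) = xi (mul c' d).
  by move=> /lfunP/(_ d); rewrite !comp_lfunE.
have dec (x : J) : exists x0 x1 : J,
    [/\ x0 \in part false, x1 \in part true & x = x0 + x1].
  have : x \in (part false + part true)%VS by rewrite (part_sum hJ) memvf.
  by move=> /memv_addP[x0 ? [x1 ? ->]]; exists x0, x1.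
rewrite (xiE a' a) ?repK //.
have [a0 [a1 [a0P a1P ->]]] := dec a.
have swap c : xi (mul (a0 + a1) c) = xi (mul c (a0 - a1)).
  by have [c0 [c1 [? ? ->]]] := dec c; apply: form_mul_swap.
by rewrite !swap; apply: xiE; apply: repK.
Qed.

End Superalgebra.

(* Main.v *)
Require Import Defs.
From mathcomp Require Import all_boot all_order all_algebra.
From mathcomp Require Import reals.
From mathcomp Require Import ring.

Import Order.TTheory GRing.Theory Num.Theory.

Local Open Scope ring_scope.

(* The operators L_(e_i) of a Jordan frame commute, have eigenvalues 0, 1/2, 1 and
   sum to the identity, so they are simultaneously diagonalised by the Peirce
   spaces, which gives J = \bigoplus_(i <= j) P_ij.  By associativity of beta,
   xi \o L_a = (L_s a)^flat for s = \sum_i lambda_i e_i, and L_s acts on P_ij as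
   mu_ij = (lambda_i + lambda_j) / 2.  As the projections onto the P_ij are
   self-adjoint, g_xi((L_s a)^flat, (L_s b)^flat) = beta(L_s a, b) is the sum of
   the mu_ij beta(a_ij, b_ij) = mu_ij^-1 beta((L_s a)_ij, (L_s b)_ij). *)

Lemma sum_pair_le (V : nmodType) (n : nat) (G : 'I_n -> 'I_n -> V) :
  \sum_(i < n) \sum_(j < n) G i j =
  \sum_(p : 'I_n * 'I_n | (p.1 <= p.2)%N)
     (if p.1 == p.2 then G p.1 p.2 else G p.1 p.2 + G p.2 p.1).
Proof.
rewrite pair_big /= (bigID (fun p : 'I_n * 'I_n => (p.1 <= p.2)%N)) /=.
pose swap (p : 'I_n * 'I_n) := (p.2, p.1).
have swapK : involutive swap by case.
rewrite [X in _ + X](reindex_inj (inv_inj swapK)) /=.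
rewrite [X in _ + X](eq_bigl
  (fun p : 'I_n * 'I_n => (p.1 <= p.2)%N && (p.1 != p.2))).
  rewrite big_mkcondr -big_split /=; apply: eq_bigr => p _.
  by case: eqP => _ /=; rewrite ?addr0.
by move=> p /=; rewrite -ltnNge ltn_neqAle andbC.
Qed.

Section PeirceDecomposition.

Context {R : realType} {J : vectType R}.
Variables (part : bool -> {vspace J}) (mul : 'Hom(J, 'End(J))).
Hypothesis hJ : jordan_superalgebra part mul.

Lemma mul_addl x y z : mul (x + y) z = mul x z + mul y z.
Proof. by rewrite linearD add_lfunE. Qed.

Lemma mul_addr x y z : mul x (y + z) = mul x y + mul x z.
Proof. exact: linearD. Qed.

Lemma mul_scaler c x y : mul x (c *: y) = c *: mul x y.
Proof. exact: linearZ. Qed.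

Lemma part_decomposition (x : J) : exists x0 x1 : J,
  [/\ x0 \in part false, x1 \in part true & x = x0 + x1].
Proof.
have : x \in (part false + part true)%VS by rewrite (part_sum hJ) memvf.
by move=> /memv_addP[x0 ? [x1 ? ->]]; exists x0, x1.
Qed.

Lemma mul_even_comm (a x : J) : a \in part false -> mul x a = mul a x.
Proof.
move=> aP; have [x0 [x1 [x0P x1P ->]]] := part_decomposition x.
rewrite !linearD add_lfunE /= (jordan_comm hJ x0P aP) (jordan_comm hJ x1P aP).
by rewrite !expr0 !scale1r.
Qed.

Section Idempotent.

Variable e : J.
Hypothesis eP : idempotent_elt part mul e.

Lemma idempotent_jordan (x y : J) :
  2 *: (mul e (mul (mul e x) y) - mul (mul e x) (mul e y)) =
  mul e (mul x y) - mul x (mul e y).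
Proof.
have [ee0 ee] := eP.
have homog k z : z \in part k ->
    2 *: (mul e (mul (mul e z) y) - mul (mul e z) (mul e y)) =
    mul e (mul z y) - mul z (mul e y).
  move=> zP; have /lfunP/(_ y) := jordan_identity hJ ee0 ee0 zP.
  rewrite /scomm /= expr0 !scale1r ee !add_lfunE !opp_lfunE !comp_lfunE /=.
  rewrite add_lfunE opp_lfunE !comp_lfunE => /eqP.
  by rewrite eq_sym subr_eq -mulr2n -scaler_nat => /eqP.
have [x0 [x1 [x0P x1P ->]]] := part_decomposition x.
rewrite !(mul_addl, mul_addr) !opprD [in RHS]addrACA.
by rewrite -(homog _ _ x0P) -(homog _ _ x1P) -scalerDr [in RHS]addrACA.
Qed.

Lemma idempotent_cubic (x : J) :
  2 *: mul e (mul e (mul e x)) = 3 *: mul e (mul e x) - mul e x.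
Proof.
have [ee0 ee] := eP; have := idempotent_jordan x e.
rewrite ee !(mul_even_comm _ _ ee0) scalerBr => /eqP.
rewrite subr_eq => /eqP ->.
by rewrite addrAC -{1}[mul e (mul e x)]scale1r -scalerDl.
Qed.

Variable f : J.
Hypotheses (fP : f \in part false) (ef : mul e f = 0).

Lemma orthogonal_commute (x : J) : mul e (mul f x) = mul f (mul e x).
Proof.
have [ee0 ee] := eP; have /lfunP/(_ x) := jordan_identity hJ fP ee0 ee0.
rewrite (mul_even_comm _ f ee0) ef ee /scomm /= expr0 !scale1r linear0.
rewrite !comp_lfun0l !comp_lfun0r !add_lfunE !opp_lfunE !comp_lfunE.
by rewrite !subrr !(oppr0, addr0, lfunE) => /eqP; rewrite subr_eq0 => /eqP.
Qed.

Lemma orthogonal_half (x : J) :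
  2 *: mul e (mul e (mul f x)) = mul e (mul f x).
Proof.
have := idempotent_jordan x f.
rewrite ef (linear0 (mul (mul e x))) (linear0 (mul x)) !subr0.
by rewrite !(mul_even_comm _ _ fP) -(orthogonal_commute x).
Qed.

Lemma orthogonal_annihilates (x : J) : mul e x = x -> mul f x = 0.
Proof.
move=> ex; have := orthogonal_half x.
rewrite !orthogonal_commute !ex => /eqP; rewrite scaler_nat mulr2n.
by rewrite -subr_eq0 addrK => /eqP.
Qed.

End Idempotent.

Section Frame.

Variables (one : J) (r : nat) (e : 'I_r -> J).
Hypotheses (hone : is_unit mul one) (he : jordan_frame part mul one e).

Lemma frame_idempotent i : idempotent_elt part mul (e i).
Proof. by case: (frame_primitive he i). Qed.

Lemma frame_even i : e i \in part false.
Proof. by case: (frame_idempotent i). Qed.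

Lemma frame_mul0 i j : i != j -> mul (e i) (e j) = 0.
Proof. by move=> /negPf ij; rewrite (frame_orthogonal he) ij. Qed.

Lemma frame_commute i j x : i != j ->
  mul (e i) (mul (e j) x) = mul (e j) (mul (e i) x).
Proof.
move=> ij; apply: (orthogonal_commute _ (frame_idempotent i)).
  exact: frame_even.
exact: frame_mul0.
Qed.

Lemma frame_mul_sum x : \sum_i mul (e i) x = x.
Proof. by rewrite -sum_lfunE -linear_sum (frame_sum he); case: (hone x). Qed.

Lemma mem_peirce i j x :
  (x \in peirce mul e i j) =
  if i == j then mul (e i) x == x
  else (mul (e i) x == 2^-1 *: x) && (mul (e j) x == 2^-1 *: x).
Proof.
rewrite /peirce; case: eqP => _; rewrite ?memv_cap !memv_ker.
  by rewrite add_lfunE opp_lfunE scale_lfunE id_lfunE scale1r subr_eq0.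
by rewrite !add_lfunE !opp_lfunE !scale_lfunE !id_lfunE div1r !subr_eq0.
Qed.

Definition peirce_weight (p : 'I_r * 'I_r) (k : 'I_r) : R :=
  ((k == p.1)%:R + (k == p.2)%:R) / 2.

Lemma peirce_eigen p k x :
  x \in peirce mul e p.1 p.2 -> mul (e k) x = peirce_weight p k *: x.
Proof.
case: p => i j; rewrite mem_peirce /peirce_weight /=.
have [<- /eqP eix|ij /andP[/eqP eix /eqP ejx]] := eqVneq i j.
  have [->|ki] := eqVneq k i; first by rewrite mulrDl -splitr scale1r.
  rewrite addr0 mul0r scale0r.
  apply: orthogonal_annihilates (frame_idempotent i) _ (frame_even k) _ _ eix.
  by rewrite frame_mul0 // eq_sym.
have [->|ki] := eqVneq k i; first by rewrite (negPf ij) addr0 div1r.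
have [->|kj] := eqVneq k j; first by rewrite add0r div1r.
rewrite addr0 mul0r scale0r.
have eijP : idempotent_elt part mul (e i + e j).
  split; first by rewrite rpredD ?frame_even.
  rewrite mul_addl !mul_addr !(frame_orthogonal he) !eqxx.
  by rewrite (eq_sym j) (negPf ij) addr0 add0r.
apply: orthogonal_annihilates eijP _ (frame_even k) _ _ _.
  by rewrite mul_addl !frame_mul0 ?addr0 // eq_sym.
by rewrite mul_addl eix ejx -scalerDl -[2^-1]div1r -splitr scale1r.
Qed.

(* The interpolation polynomials in the commuting operators L_(e_i) that take the
   value 1 on P_ij and 0 on the other Peirce spaces. *)
Definition peirce_proj (p : 'I_r * 'I_r) : 'End(J) :=
  if p.1 == p.2 then 2 *: (mul (e p.1) \o mul (e p.1))%VF - mul (e p.1)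
  else 4 *: (mul (e p.1) \o mul (e p.2))%VF.

Lemma peirce_projE p x :
  peirce_proj p x =
  if p.1 == p.2 then 2 *: mul (e p.1) (mul (e p.1) x) - mul (e p.1) x
  else 4 *: mul (e p.1) (mul (e p.2) x).
Proof.
by rewrite /peirce_proj; case: ifP => _;
   rewrite ?add_lfunE ?opp_lfunE scale_lfunE comp_lfunE.
Qed.

Lemma peirce_proj_mem p x : peirce_proj p x \in peirce mul e p.1 p.2.
Proof.
case: p => i j; rewrite mem_peirce peirce_projE /=.
have [_|ij] := eqVneq i j.
  rewrite linearB linearZ /= (idempotent_cubic _ (frame_idempotent i)).
  by rewrite -[3]natr1 scalerDl scale1r addrAC addrK.
have half k l : k != l ->
    mul (e k) (mul (e k) (mul (e l) x)) = 2^-1 *: mul (e k) (mul (e l) x).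
  move=> kl.
  have kl0 := frame_mul0 k l kl.
  rewrite -[in RHS](orthogonal_half _ (frame_idempotent k) _ (frame_even l)) //.
  by rewrite scalerA mulVf ?scale1r ?pnatr_eq0.
have ji : j != i by rewrite eq_sym.
rewrite !linearZ /= half //.
rewrite [in X in _ && X](frame_commute i j) //.
by rewrite half // !scalerA ![4 * _]mulrC !eqxx.
Qed.

Lemma peirce_proj_sum x :
  \sum_(p : 'I_r * 'I_r | (p.1 <= p.2)%N) peirce_proj p x = x.
Proof.
have sq : \sum_i \sum_j mul (e i) (mul (e j) x) = x.
  rewrite (eq_bigr _ (fun i _ => esym (linear_sum (mul (e i)) _ _ _))) /=.
  by rewrite frame_mul_sum frame_mul_sum.
have lin : \sum_i \sum_j (if i == j then mul (e i) x else 0) = x.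
  rewrite -[RHS]frame_mul_sum; apply: eq_bigr => i _.
  by rewrite -big_mkcond (big_pred1 i) // => j; rewrite /= eq_sym.
transitivity (2 *: x - x); last by rewrite scaler_nat mulr2n addrK.
rewrite -[X in _ = _ *: X - _]sq -[X in _ = _ - X]lin.
rewrite !sum_pair_le scaler_sumr -sumrB; apply: eq_bigr => -[i j] _.
rewrite peirce_projE /=; have [<-//|ij] := eqVneq i j.
rewrite addr0 subr0.
rewrite -(frame_commute i j) //.
by rewrite -mulr2n -scaler_nat scalerA -natrM.
Qed.

Lemma peirce_proj_id (p q : 'I_r * 'I_r) x :
  (p.1 <= p.2)%N -> (q.1 <= q.2)%N -> x \in peirce mul e q.1 q.2 ->
  peirce_proj p x = if p == q then x else 0.
Proof.
move=> lep leq xq; rewrite peirce_projE !(peirce_eigen _ _ _ xq).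
rewrite !mul_scaler !(peirce_eigen _ _ _ xq) !scalerA -scalerBl.
rewrite -[if p == q then x else 0](_ : (p == q)%:R *: x = _); last first.
  by case: (p == q); rewrite ?scale1r ?scale0r.
rewrite -(fun_if (fun c => c *: x)); congr (_ *: x).
case: p q lep leq {xq} => [i j] [k l] /= lep leq.
rewrite /peirce_weight xpair_eqE /=.
have [eij|ij] := eqVneq i j.
  rewrite -{}eij /=.
  by have [_|_] := eqVneq i k; have [_|_] := eqVneq i l => /=; field.
have [<-|ik] := eqVneq i k.
  rewrite (eq_sym j i) (negPf ij).
  have [<-|_] := eqVneq i l; first by rewrite eq_sym (negPf ij) /=; field.
  by case: (j == l) => /=; field.
have [eil|il] := eqVneq i l; last by rewrite /=; field.
have [ejk|_] := eqVneq j k; last first.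
  by rewrite -eil (eq_sym j) (negPf ij) /=; field.
by case/eqP: ij; apply/val_inj/eqP; rewrite eqn_leq lep ejk eil leq.
Qed.

Lemma peirce_proj_comp (p q : 'I_r * 'I_r) x :
  (p.1 <= p.2)%N -> (q.1 <= q.2)%N ->
  peirce_proj p (peirce_proj q x) = if p == q then peirce_proj q x else 0.
Proof. by move=> lep leq; apply: peirce_proj_id (peirce_proj_mem q x). Qed.

Section Diagonal.

Variable lambda : 'I_r -> R.

Let s := \sum_i lambda i *: e i.

Lemma diagonal_peirce (p : 'I_r * 'I_r) x : x \in peirce mul e p.1 p.2 ->
  mul s x = ((lambda p.1 + lambda p.2) / 2) *: x.
Proof.
move=> xp; rewrite linear_sum sum_lfunE /=.
transitivity (\sum_i (lambda i * peirce_weight p i) *: x).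
  apply: eq_bigr => i _.
  by rewrite linearZ scale_lfunE (peirce_eigen _ _ _ xp) scalerA.
rewrite -scaler_suml; congr (_ *: _).
have delta k : \sum_i lambda i * (i == k)%:R = lambda k.
  rewrite (bigD1 k) //= eqxx mulr1 big1 ?addr0 // => i /negPf ->.
  by rewrite mulr0.
rewrite -(delta p.1) -(delta p.2) -big_split mulr_suml /=.
by apply: eq_bigr => i _; rewrite -mulrDr mulrA.
Qed.

Lemma peirce_proj_diagonal (p : 'I_r * 'I_r) x : (p.1 <= p.2)%N ->
  peirce_proj p (mul s x) = ((lambda p.1 + lambda p.2) / 2) *: peirce_proj p x.
Proof.
move=> lep; rewrite -{1}[x]peirce_proj_sum.
rewrite (linear_sum (mul s)) (linear_sum (peirce_proj p)) (bigD1 p) //=.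
rewrite (diagonal_peirce _ _ (peirce_proj_mem _ _)) linearZ /=.
rewrite peirce_proj_comp // eqxx.
rewrite big1 ?addr0 // => q /andP[leq qp].
rewrite (diagonal_peirce _ _ (peirce_proj_mem _ _)) linearZ /= peirce_proj_comp //.
by rewrite eq_sym (negPf qp) scaler0.
Qed.

End Diagonal.

Section Form.

Variable beta : 'Hom(J, 'Hom(J, R^o)).
Hypothesis hbeta : pseudo_euclidean part mul beta.

Lemma form_lker0 : lker beta == 0%VS.
Proof.
apply/eqP/vspaceP => x; rewrite memv_ker memv0; apply/eqP/eqP => [bx|->].
  by apply: (form_nondegenerate hbeta) => y; rewrite bx lfunE.
exact: linear0.
Qed.

Lemma beta_flatE x y : beta_flat beta (beta x) (beta y) = beta x y.
Proof. by rewrite /beta_flat /sharp !(lker0_lfunK form_lker0). Qed.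

Lemma vf_value_flat a x : vf_value mul (beta a) x = beta (mul a x).
Proof. by apply/lfunP=> y; rewrite comp_lfunE (form_assoc hbeta). Qed.

Lemma form_frame_adjoint i x y : beta (mul (e i) x) y = beta x (mul (e i) y).
Proof. by rewrite -(mul_even_comm _ _ (frame_even i)) (form_assoc hbeta). Qed.

Lemma peirce_proj_adjoint (p : 'I_r * 'I_r) x y :
  beta (peirce_proj p x) y = beta x (peirce_proj p y).
Proof.
rewrite !peirce_projE; have [_|ij] := eqVneq p.1 p.2.
  rewrite linearB linearZ /= add_lfunE opp_lfunE scale_lfunE !form_frame_adjoint.
  by rewrite [RHS]linearB linearZ.
rewrite linearZ scale_lfunE /= !form_frame_adjoint [RHS]linearZ.
by rewrite (frame_commute p.1 p.2).
Qed.

Lemma peirce_proj_form (p : 'I_r * 'I_r) x y : (p.1 <= p.2)%N ->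
  beta (peirce_proj p x) y = beta (peirce_proj p x) (peirce_proj p y).
Proof.
by move=> lep; rewrite -peirce_proj_adjoint peirce_proj_comp // eqxx.
Qed.

Lemma peirce_flat_projE (p : 'I_r * 'I_r) x : (p.1 <= p.2)%N ->
  peirce_flat_proj mul beta e p (beta x) = beta (peirce_proj p x).
Proof.
move=> lep; rewrite /peirce_flat_proj; set V := (\sum_(q | _) _)%VS.
have bxV : beta x \in V.
  rewrite -[x]peirce_proj_sum linear_sum; apply: memv_sumr => q _.
  by rewrite memv_img ?peirce_proj_mem.
pose z q := sharp beta (sumv_pi V q (beta x)).
have zP q : z q \in peirce mul e q.1 q.2 /\ beta (z q) = sumv_pi V q (beta x).
  have /memv_imgP[u uq zE] := memv_sum_pi (erefl V) q (beta x).
  by rewrite /z zE /sharp (lker0_lfunK form_lker0).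
have xE : x = \sum_(q : 'I_r * 'I_r | (q.1 <= q.2)%N) z q.
  apply: (lker0P form_lker0); rewrite linear_sum -{1}(sumv_pi_sum (erefl V) bxV).
  by apply: eq_bigr => q _; case: (zP q).
rewrite -(zP p).2 xE linear_sum (bigD1 p) //=.
rewrite (peirce_proj_id _ _ _ _ _ (zP p).1) // eqxx.
rewrite big1 ?addr0 // => q /andP[leq qp].
by rewrite (peirce_proj_id _ _ _ _ _ (zP q).1) // eq_sym (negPf qp).
Qed.

Variable lambda : 'I_r -> R.

Let s := \sum_i lambda i *: e i.

Lemma flat_diagonal : \sum_i lambda i *: beta (e i) = beta s.
Proof. by rewrite linear_sum; apply: eq_bigr => i _; rewrite linearZ. Qed.

Lemma even_form_diagonal : even_form part (beta s).
Proof.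
move=> x xP; apply: (form_even hbeta (i := false)) xP => //.
by rewrite rpred_sum // => i _; rewrite rpredZ ?frame_even.
Qed.

Lemma mem_distribution y :
  reflect (exists a, y = beta (mul s a)) (y \in distribution mul (beta s)).
Proof.
apply: (iffP memv_imgP) => [[a _ ->]|[a ->]]; exists a.
- by rewrite lfunE /= vf_value_flat.
- exact: memvf.
- by rewrite lfunE /= vf_value_flat.
Qed.

Lemma distribution_sub :
  (distribution mul (beta s) <=
     \sum_(p : 'I_r * 'I_r | (p.1 <= p.2)%N
              && ((lambda p.1 != 0) || (lambda p.2 != 0))%R)
        peirce_flat mul beta e p.1 p.2)%VS.
Proof.
apply/subvP => _ /mem_distribution[a ->].
rewrite -[mul s a]peirce_proj_sum linear_sum; apply: rpred_sum => p lep.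
have [p0|pN] := boolP ((lambda p.1 != 0) || (lambda p.2 != 0)).
  apply: subvP (memv_img beta (peirce_proj_mem p _)).
  by apply: (sumv_sup p); rewrite ?lep.
move: pN; rewrite negb_or !negbK => /andP[/eqP l1 /eqP l2].
by rewrite peirce_proj_diagonal // l1 l2 addr0 mul0r scale0r linear0 mem0v.
Qed.

Lemma distribution_sup :
  (forall i j : 'I_r, (i <= j)%N -> (lambda i != 0) || (lambda j != 0) ->
      peirce mul e i j != 0%VS -> lambda i + lambda j != 0) ->
  (\sum_(p : 'I_r * 'I_r | (p.1 <= p.2)%N
              && ((lambda p.1 != 0) || (lambda p.2 != 0))%R)
        peirce_flat mul beta e p.1 p.2 <= distribution mul (beta s))%VS.
Proof.
move=> nz; apply/subv_sumP => p /andP[lep lp].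
apply/subvP => _ /memv_imgP[z zp ->]; apply/mem_distribution.
have [->|z0] := eqVneq z 0; first by exists 0; rewrite (linear0 (mul s)).
have P0 : peirce mul e p.1 p.2 != 0%VS.
  by apply: contraNneq z0 => P0; rewrite -memv0 -P0.
exists (((lambda p.1 + lambda p.2) / 2)^-1 *: z).
rewrite mul_scaler (diagonal_peirce _ _ _ zp) scalerA mulVf ?scale1r //.
by rewrite mulf_neq0 ?invr_eq0 ?pnatr_eq0 ?nz.
Qed.

Lemma canonical_pairing_diagonal (x1 x2 : 'Hom(J, R^o)) :
  x1 \in distribution mul (beta s) -> x2 \in distribution mul (beta s) ->
  canonical_pairing mul (beta s) x1 x2 =
    \sum_(p : 'I_r * 'I_r | (p.1 <= p.2)%N
             && ((lambda p.1 != 0) || (lambda p.2 != 0))%R)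
       2 / (lambda p.1 + lambda p.2) * beta_flat_on mul beta e p.1 p.2 x1 x2.
Proof.
move=> /mem_distribution[a ->] /mem_distribution[b ->].
rewrite -!vf_value_flat (canonical_pairingE _ _ hJ even_form_diagonal).
rewrite -(form_assoc hbeta) -[mul s a]peirce_proj_sum linear_sum sum_lfunE.
rewrite big_mkcondr; apply: eq_bigr => -[i j] /= lep.
rewrite !vf_value_flat /beta_flat_on !peirce_flat_projE // beta_flatE.
rewrite !peirce_proj_diagonal //= linearZ scale_lfunE linearZ /= scale_lfunE.
rewrite peirce_proj_form //.
set m := _ / 2; set X : R := beta _ _.
change (m * X = if (lambda i != 0) || (lambda j != 0)
                then 2 / (lambda i + lambda j) * (m * (m * X)) else 0).
rewrite {}/m; case: ifPn => [_|]; last first.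
  by rewrite negb_or !negbK => /andP[/eqP -> /eqP ->]; rewrite addr0 !mul0r.
have [->|sN] := eqVneq (lambda i + lambda j) 0; first by rewrite !mul0r mulr0.
by field.
Qed.

End Form.
End Frame.
End PeirceDecomposition.

Theorem proposition5p3 (R : realType) (J : vectType R)
    (part : bool -> {vspace J}) (mul : 'Hom(J, 'End(J))) (one : J)
    (beta : 'Hom(J, 'Hom(J, R^o)))
    (hJ : jordan_superalgebra part mul)
    (hone : is_unit mul one)
    (hbeta : pseudo_euclidean part mul beta)
    (hpos : positive_even_part part mul)
    (r : nat) (e : 'I_r -> J) (he : jordan_frame part mul one e)
    (lambda : 'I_r -> R) (xi : 'Hom(J, R^o))
    (hxi : xi = \sum_(i < r) lambda i *: beta (e i)) :
  (distribution mul xi <=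
     \sum_(p : 'I_r * 'I_r | (p.1 <= p.2)%N
              && ((lambda p.1 != 0) || (lambda p.2 != 0))%R)
        peirce_flat mul beta e p.1 p.2)%VS
  /\
  ((forall i j : 'I_r, (i <= j)%N -> (lambda i != 0) || (lambda j != 0) ->
      peirce mul e i j != 0%VS -> lambda i + lambda j != 0) ->
   distribution mul xi =
     (\sum_(p : 'I_r * 'I_r | (p.1 <= p.2)%N
              && ((lambda p.1 != 0) || (lambda p.2 != 0))%R)
        peirce_flat mul beta e p.1 p.2)%VS)
  /\
  (forall x1 x2 : 'Hom(J, R^o),
     x1 \in distribution mul xi -> x2 \in distribution mul xi ->
     canonical_pairing mul xi x1 x2 =
       \sum_(p : 'I_r * 'I_r | (p.1 <= p.2)%N
              && ((lambda p.1 != 0) || (lambda p.2 != 0))%R)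
          2 / (lambda p.1 + lambda p.2) * beta_flat_on mul beta e p.1 p.2 x1 x2).
Proof.
rewrite hxi flat_diagonal; split; last split.
- exact: (distribution_sub _ _ hJ _ _ _ hone he _ hbeta).
- move=> nz; apply/eqP; rewrite eqEsubv.
  rewrite (distribution_sub _ _ hJ _ _ _ hone he _ hbeta).
  exact: (distribution_sup _ _ hJ _ _ _ he _ hbeta).
- exact: (canonical_pairing_diagonal _ _ hJ _ _ _ hone he _ hbeta).
Qed.
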